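(* Let $w=[x^\top,y^\top,z^\top]^\top$ be the unique solution of the double saddle point problem $\mathfrak{B}w=b$, and let $L\in\mathbb{R}^{k\times l}$. Take $\tau=\gamma=2$ and assume that $\Psi$, $\chi$ and $\xi_L$ are positive real numbers. Then the partial condition number $\mathfrak{K}^{(2)}_{\varphi}(\mathbf{H},b;L)$ of $w$ with respect to $L$ has the following two forms: $$\mathfrak{K}^{(2)}_{\varphi}(\mathbf{H},b;L)=\frac{\left\|L\mathfrak{B}^{-1}\begin{bmatrix}\Psi\mathcal{G}&-\chi I_l\end{bmatrix}\right\|_2}{\xi_L}$$ and $$\mathfrak{K}^{(2)}_{\varphi}(\mathbf{H},b;L)=\frac{\left\|L\mathfrak{B}^{-1}(\Psi^2\mathcal{J}+\chi^2I_l)(\mathfrak{B}^{-1})^\top L^\top\right\|_2^{1/2}}{\xi_L},$$ where $$\mathcal{J}=\begin{bmatrix} (\|x\|_2^2+\|y\|_2^2)I_n & xy^\top & 0 \\ yx^\top & (\|x\|_2^2+\|y\|_2^2+\|z\|_2^2)I_m & yz^\top \\ 0 & zy^\top & (\|y\|_2^2+\|z\|_2^2)I_p \end{bmatrix}\in\mathbb{R}^{l\times l}.$$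
   Context: Let $A\in\mathbb{R}^{n\times n}$, $B\in\mathbb{R}^{m\times n}$, $C\in\mathbb{R}^{p\times m}$, $D\in\mathbb{R}^{m\times m}$, $E\in\mathbb{R}^{p\times p}$, $l=n+m+p$, $b\in\mathbb{R}^{l}$, and $$\mathfrak{B}=\begin{bmatrix} A & B^\top & 0 \\ B & -D & C^\top \\ 0 & C & E \end{bmatrix},$$ which is assumed nonsingular throughout. The double saddle point problem (DSPP) is $\mathfrak{B}w=b$ with $w=[x^\top,y^\top,z^\top]^\top$, $x\in\mathbb R^n$, $y\in\mathbb R^m$, $z\in\mathbb R^p$. $\mathrm{vec}$ stacks the columns of a matrix; for a tuple, $\mathrm{vec}(X_1,\dots,X_r)=[\mathrm{vec}(X_1)^\top,\dots,\mathrm{vec}(X_r)^\top]^\top$. $\otimes$ is the Kronecker product; $\|\cdot\|_2$ is the Euclidean norm for vectors and the spectral norm for matrices. Write $\mathbf{H}=(A,B,C,D,E)$, $s=n^2+m^2+p^2+nm+mp$, and $$\mathcal{G}=\begin{bmatrix} x^\top\otimes I_n & I_n\otimes y^\top & 0 & 0 & 0 \\ 0 & x^\top\otimes I_m & I_m\otimes z^\top & -y^\top\otimes I_m & 0 \\ 0 & 0 & y^\top\otimes I_p & 0 & z^\top\otimes I_p \end{bmatrix}\in\mathbb{R}^{l\times s}.$$ For $L\in\mathbb{R}^{k\times l}$ ($k\le l$) put $\varphi(\mathbf{H},b)=L\mathfrak{B}^{-1}b$. For positive real parameters $\Psi,\chi,\xi_L$ and $\tau=\gamma=2$, the partial condition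 number of $w$ with respect to $L$ is $$\mathfrak{K}^{(2)}_{\varphi}(\mathbf{H},b;L)=\lim_{\epsilon\to0}\ \sup_{0<\|\mathrm{vec}(\Psi^{-1}\Delta\mathbf{H},\,\chi^{-1}\Delta b)\|_2\le\epsilon}\frac{\xi_L^{-1}\|\varphi(\mathbf{H}+\Delta\mathbf{H},b+\Delta b)-\varphi(\mathbf{H},b)\|_2}{\|\mathrm{vec}(\Psi^{-1}\Delta\mathbf{H},\,\chi^{-1}\Delta b)\|_2},$$ where $\Delta\mathbf{H}=(\Delta A,\Delta B,\Delta C,\Delta D,\Delta E)$ and $\Delta b\in\mathbb R^l$ are perturbations of $\mathbf{H}$ and $b$. *)

(* Defs.v *)
From HB Require Import structures.
From mathcomp Require Import all_boot all_order all_algebra.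
From mathcomp Require Import mxtens.
From mathcomp Require Import all_classical all_reals all_analysis.
Import Order.TTheory GRing.Theory Num.Theory.
Import numFieldNormedType.Exports.

Set Implicit Arguments.
Unset Strict Implicit.
Unset Printing Implicit Defensive.

Local Open Scope classical_set_scope.
Local Open Scope ring_scope.

(* The norm `|_| that the library puts on matrices is the max norm, so the
   Euclidean and spectral norms are defined here. *)
Definition norm2 (R : realType) (n : nat) (u : 'cV[R]_n) : R :=
  Num.sqrt (\sum_(i < n) u i 0 ^+ 2).

Definition spectral_norm (R : realType) (m n : nat) (M : 'M[R]_(m, n)) : R :=
  sup [set norm2 (M *m v) | v in [set v : 'cV[R]_n | norm2 v <= 1]].

(* mxvec is row-major, whence the transpose to stack columns. *)
Definition vec (R : Type) (m n : nat) (M : 'M[R]_(m, n)) : 'cV[R]_(n * m) :=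
  (mxvec M^T)^T.

(* Kronecker products with a row vector r; the casts only turn the row
   dimensions 1 * q and q * 1 into q. *)
Definition kron_row_id (R : pzRingType) (n q : nat) (r : 'rV[R]_n) :
  'M[R]_(q, n * q) := castmx (mul1n q, erefl) (r *t (1%:M : 'M[R]_q)).

Definition kron_id_row (R : pzRingType) (n q : nat) (r : 'rV[R]_n) :
  'M[R]_(q, q * n) := castmx (muln1 q, erefl) ((1%:M : 'M[R]_q) *t r).

Definition block3 (R : Type) (m1 m2 m3 n1 n2 n3 : nat)
    (M11 : 'M[R]_(m1, n1)) (M12 : 'M[R]_(m1, n2)) (M13 : 'M[R]_(m1, n3))
    (M21 : 'M[R]_(m2, n1)) (M22 : 'M[R]_(m2, n2)) (M23 : 'M[R]_(m2, n3))
    (M31 : 'M[R]_(m3, n1)) (M32 : 'M[R]_(m3, n2)) (M33 : 'M[R]_(m3, n3)) :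
    'M[R]_(m1 + (m2 + m3), n1 + (n2 + n3)) :=
  col_mx (row_mx M11 (row_mx M12 M13))
 (col_mx (row_mx M21 (row_mx M22 M23))
         (row_mx M31 (row_mx M32 M33))).

(* The data H = (A, B, C, D, E); sums and scalings of such tuples are the
   componentwise ones of the product module. *)
Notation dspp_data R n m p :=
  ('M[R]_n * 'M[R]_(m, n) * 'M[R]_(p, m) * 'M[R]_m * 'M[R]_p)%type.

Definition dspp_mx (R : realType) (n m p : nat) (H : dspp_data R n m p) :
    'M[R]_(n + (m + p)) :=
  let: (A, B, C, D, E) := H in
  block3 A B^T 0
         B (- D) C^T
         0 C E.

(* The last component is already a column vector, hence equal to its vec. *)
Definition vec_data (R : realType) (n m p : nat) (H : dspp_data R n m p)
    (b : 'cV[R]_(n + (m + p))) :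
    'cV[R]_(n * n + (n * m + (m * p + (m * m + p * p))) + (n + (m + p))) :=
  let: (A, B, C, D, E) := H in
  col_mx (col_mx (vec A) (col_mx (vec B) (col_mx (vec C)
         (col_mx (vec D) (vec E))))) b.

Definition calG (R : realType) (n m p : nat)
    (x : 'cV[R]_n) (y : 'cV[R]_m) (z : 'cV[R]_p) :
    'M[R]_(n + (m + p), n * n + (n * m + (m * p + (m * m + p * p)))) :=
  col_mx (row_mx (kron_row_id n x^T) (row_mx (kron_id_row n y^T)
           (row_mx 0 (row_mx 0 0))))
 (col_mx (row_mx 0 (row_mx (kron_row_id m x^T)
           (row_mx (kron_id_row m z^T) (row_mx (- kron_row_id m y^T) 0))))
         (row_mx 0 (row_mx 0 (row_mx (kron_row_id p y^T)
           (row_mx 0 (kron_row_id p z^T)))))).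

Definition calJ (R : realType) (n m p : nat)
    (x : 'cV[R]_n) (y : 'cV[R]_m) (z : 'cV[R]_p) : 'M[R]_(n + (m + p)) :=
  block3 (norm2 x ^+ 2 + norm2 y ^+ 2)%:M (x *m y^T) 0
         (y *m x^T) (norm2 x ^+ 2 + norm2 y ^+ 2 + norm2 z ^+ 2)%:M (y *m z^T)
         0 (z *m y^T) (norm2 y ^+ 2 + norm2 z ^+ 2)%:M.

Definition phi (R : realType) (n m p k : nat) (L : 'M[R]_(k, n + (m + p)))
    (H : dspp_data R n m p) (b : 'cV[R]_(n + (m + p))) : 'cV[R]_k :=
  L *m invmx (dspp_mx H) *m b.

(* The supremum over perturbations of scaled size at most eps. It is taken in
   the extended reals, as it can be infinite unless eps is small. Where the
   perturbed matrix is singular, invmx has an arbitrary value; around a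
   nonsingular matrix this does not happen for small eps, so the limit below
   does not depend on it. *)
Definition cond_sup (R : realType) (n m p k : nat) (Psi chi xiL : R)
    (L : 'M[R]_(k, n + (m + p))) (H : dspp_data R n m p)
    (b : 'cV[R]_(n + (m + p))) (eps : R) : \bar R :=
  ereal_sup
    [set (xiL^-1 * norm2 (phi L (H + d.1) (b + d.2) - phi L H b)
          / norm2 (vec_data (Psi^-1 *: d.1) (chi^-1 *: d.2)))%:E
    | d in [set d : dspp_data R n m p * 'cV[R]_(n + (m + p)) |
        0 < norm2 (vec_data (Psi^-1 *: d.1) (chi^-1 *: d.2)) <= eps]].

Definition partial_cond (R : realType) (n m p k : nat) (Psi chi xiL : R)
    (L : 'M[R]_(k, n + (m + p))) (H : dspp_data R n m p)
    (b : 'cV[R]_(n + (m + p))) : \bar R :=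
  lim (cond_sup Psi chi xiL L H b eps @[eps --> 0^'+]).

(* Main.v *)
Require Import Defs.
From HB Require Import structures.
From mathcomp Require Import all_boot all_order all_algebra.
From mathcomp Require Import mxtens.
From mathcomp Require Import all_classical all_reals all_analysis.
From mathcomp Require Import ring lra.
Import Order.TTheory GRing.Theory Num.Theory.
Import numFieldNormedType.Exports.

Set Implicit Arguments.
Unset Strict Implicit.
Unset Printing Implicit Defensive.

Local Open Scope classical_set_scope.
Local Open Scope ring_scope.

(** Write [B] for the double saddle point matrix of the data [H], [w] for the
    solution of [B w = b] and [B + Delta] for the matrix of the perturbed data.
    Subtracting [w] from the perturbed solution gives the exact identity
<<
      (B + Delta)^-1 (b + db) - w  =  (B + Delta)^-1 (db - Delta w).
>>
    The entries of [Delta w] depend linearly on those of the perturbation [dH], and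
    the matrix [G] of the statement is the one with [Delta w = G vec(dH)]
    ([calG_vecH]). If [v] is the scaled perturbation vector, made of
    [Psi^-1 vec(dH)] and [chi^-1 db], then [db - Delta w = - N v] with
    [N = [Psi G, - chi I]]: the scaling is absorbed in [N] and the difference
    quotient is exactly [|L (B + Delta)^-1 N v| / (xiL |v|)] ([phi_perturb]).

    It remains to replace [(B + Delta)^-1] by [B^-1] uniformly in [v]. Since
    [|Delta u| <= const |v| |u|] ([norm2_dspp_mulmx]), the Neumann argument of
    [invmx_perturb] shows that, for [|v| <= eps] with [eps] small, [B + Delta] is
    invertible and its inverse is at distance [O(eps)] from [B^-1]. The quotient
    is therefore within [O(eps)] of [|M v| / (xiL |v|)], where [M = L B^-1 N]
    ([phi_first_order]). The last expression is invariant under scaling of [v],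
    and every direction [v] is attained, so its supremum over the perturbations
    of size at most [eps] is the spectral norm of [M] over [xiL] whatever [eps]
    is. Squeezing gives the limit ([cond_sup_bounds], [cond_sup_cvg]), which is
    the first formula.

    The second formula is [|M|^2 = |M M^T|] ([spectral_norm_mulmx_tr]) together
    with [N N^T = Psi^2 J + chi^2 I] ([calN_gram]), that is, [G G^T = J]
    ([calG_gram]). The same Gram identity also yields the bound on [|Delta u|]:
    [Delta u] is [G] formed at [u] applied to [vec(dH)], so its norm is controlled
    by the Frobenius norm of [G], the square root of the trace of [J]. *)

(** * Euclidean norm *)

Section EuclideanNorm.
Variables (R : realType) (n : nat).
Implicit Types u v : 'cV[R]_n.

Lemma norm2_ge0 u : 0 <= norm2 u.
Proof. exact: sqrtr_ge0. Qed.

Lemma norm2_sqr u : norm2 u ^+ 2 = \sum_i u i 0 ^+ 2.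
Proof. by rewrite sqr_sqrtr // sumr_ge0 // => i _; exact: sqr_ge0. Qed.

Lemma norm2_sqr_dot u : norm2 u ^+ 2 = (u^T *m u) 0 0.
Proof.
by rewrite norm2_sqr mxE; apply: eq_bigr => i _; rewrite mxE expr2.
Qed.

Lemma dotC u v : (u^T *m v) 0 0 = (v^T *m u) 0 0.
Proof. by rewrite -[u in RHS]trmxK -trmx_mul [RHS]mxE. Qed.

Lemma norm2_eq0 u : (norm2 u == 0) = (u == 0).
Proof.
apply/idP/eqP => [u0|->]; last first.
  by rewrite -sqrf_eq0 norm2_sqr_dot mulmx0 mxE.
apply/colP => i; rewrite mxE; apply/eqP; rewrite -sqrf_eq0.
have /eqP : norm2 u ^+ 2 = 0 by rewrite (eqP u0) expr0n.
rewrite norm2_sqr psumr_eq0 => [/allP/(_ i)|j _]; last exact: sqr_ge0.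
by apply; rewrite mem_index_enum.
Qed.

Lemma norm20 : norm2 (0 : 'cV[R]_n) = 0.
Proof. by apply/eqP; rewrite norm2_eq0. Qed.

Lemma norm2Z a u : norm2 (a *: u) = `|a| * norm2 u.
Proof.
apply/eqP; rewrite -(@eqrXn2 _ 2) ?mulr_ge0 ?norm2_ge0 //.
rewrite exprMn real_normK ?num_real // !norm2_sqr mulr_sumr.
by under eq_bigr => i _ do rewrite mxE exprMn.
Qed.

Lemma norm2N u : norm2 (- u) = norm2 u.
Proof. by rewrite -scaleN1r norm2Z normrN1 mul1r. Qed.

(** For [a = |u|^2], [c = u.v] and [b = |v|^2], the inequality is the
    nonnegativity of [|b u - c v|^2 = b (a b - c^2)]; when [b = 0] the vector
    [v] vanishes and there is nothing to compare. *)
Lemma dot_le_norm2 u v : (u^T *m v) 0 0 <= norm2 u * norm2 v.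
Proof.
have [->|v0] := eqVneq v 0; first by rewrite mulmx0 mxE norm20 mulr0.
have nv0 : 0 < norm2 v by rewrite lt_def norm2_eq0 v0 norm2_ge0.
set c := (u^T *m v) 0 0; set b := norm2 v ^+ 2; set a := norm2 u ^+ 2.
have b0 : 0 < b by rewrite exprn_gt0.
have E : norm2 (b *: u - c *: v) ^+ 2 = b * (a * b - c ^+ 2).
  have E1 : (u^T *m u) 0 0 = a by rewrite -norm2_sqr_dot.
  have E2 : (v^T *m v) 0 0 = b by rewrite -norm2_sqr_dot.
  have E3 : (v^T *m u) 0 0 = c by rewrite dotC.
  have trZ e (w : 'cV[R]_n) : (e *: w)^T = e *: w^T by exact: linearZ.
  rewrite norm2_sqr_dot [(_ - _)^T]linearB /= !trZ.
  rewrite mulmxBl !mulmxBr.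
  rewrite -!scalemxAl -!scalemxAr !scalerA.
  have E4 : (u^T *m v) 0 0 = c by [].
  move: E1 E2 E3 E4; move: (u^T *m u) (v^T *m v) (v^T *m u) (u^T *m v).
  by move=> P Q S T; rewrite !mxE => -> -> -> ->; ring.
have : 0 <= b * (a * b - c ^+ 2) by rewrite -E sqr_ge0.
rewrite pmulr_rge0 // subr_ge0 -exprMn => cab.
apply: le_trans (ler_norm _) _.
rewrite -(@ler_pXn2r _ 2) ?nnegrE ?mulr_ge0 ?norm2_ge0 //.
by rewrite real_normK ?num_real.
Qed.

Lemma ler_norm2D u v : norm2 (u + v) <= norm2 u + norm2 v.
Proof.
rewrite -(@ler_pXn2r _ 2) ?nnegrE ?addr_ge0 ?norm2_ge0 //.
have := dot_le_norm2 u v.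
rewrite sqrrD !norm2_sqr_dot [(_ + _)^T]linearD /= mulmxDl !mulmxDr.
have := dotC u v.
move: (u^T *m u) (v^T *m v) (v^T *m u) (u^T *m v).
by move=> P Q S T; rewrite !mxE => ->; lra.
Qed.

Lemma ler_norm2B u v : norm2 (u - v) <= norm2 u + norm2 v.
Proof. by rewrite (le_trans (ler_norm2D _ _)) // norm2N. Qed.

End EuclideanNorm.

Lemma norm2_col_mx (R : realType) (n1 n2 : nat) (u : 'cV[R]_n1) (v : 'cV[R]_n2) :
  norm2 (col_mx u v) ^+ 2 = norm2 u ^+ 2 + norm2 v ^+ 2.
Proof.
by rewrite !norm2_sqr_dot tr_col_mx mul_row_col mxE.
Qed.

(** * Spectral norm *)

Section SpectralNorm.
Variable R : realType.

(** The trace of [M M^T] is the squared Frobenius norm of [M]; the inequality is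
    Cauchy-Schwarz applied to each row of [M]. *)
Lemma norm2_mulmx_trace (m n : nat) (M : 'M[R]_(m, n)) v :
  norm2 (M *m v) ^+ 2 <= \tr (M *m M^T) * norm2 v ^+ 2.
Proof.
rewrite norm2_sqr mulr_suml ler_sum // => i _.
have -> : (M *m M^T) i i = norm2 (row i M)^T ^+ 2.
  by rewrite norm2_sqr !mxE; apply: eq_bigr => j _; rewrite !mxE expr2.
have -> : (M *m v) i 0 = ((row i M)^T^T *m v) 0 0.
  by rewrite trmxK -row_mul [RHS]mxE.
have oppE (P : 'M[R]_1) : (- P) 0 0 = - P 0 0 by rewrite mxE.
have := dot_le_norm2 (row i M)^T (- v).
have := dot_le_norm2 (row i M)^T v.
rewrite norm2N mulmxN oppE => h2 h1.
rewrite -exprMn -[leLHS]real_normK ?num_real //.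
by rewrite ler_pXn2r ?nnegrE ?mulr_ge0 ?norm2_ge0 // ler_norml h2 andbT lerNl.
Qed.

Lemma spectral_norm_has_sup (m n : nat) (M : 'M[R]_(m, n)) :
  has_sup [set norm2 (M *m v) | v in [set v : 'cV[R]_n | norm2 v <= 1]].
Proof.
split; first by exists (norm2 (M *m 0)), 0 => //=; rewrite norm20 ler01.
exists (Num.sqrt (\tr (M *m M^T))) => _ [v /= v1 <-].
rewrite -[leLHS]ger0_norm ?norm2_ge0 // -sqrtr_sqr ler_wsqrtr //.
have T0 : 0 <= \tr (M *m M^T).
  rewrite sumr_ge0 // => i _; rewrite mxE sumr_ge0 // => j _.
  by rewrite mxE -expr2 sqr_ge0.
rewrite (le_trans (norm2_mulmx_trace M v)) // -[leRHS]mulr1 ler_wpM2l //.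
by rewrite expr_le1 ?norm2_ge0.
Qed.

Lemma spectral_norm_ge0 (m n : nat) (M : 'M[R]_(m, n)) : 0 <= spectral_norm M.
Proof.
have := sup_upper_bound (spectral_norm_has_sup M); apply.
by exists 0; rewrite /= ?mulmx0 norm20.
Qed.

Lemma norm2_mulmx_le (m n : nat) (M : 'M[R]_(m, n)) v :
  norm2 (M *m v) <= spectral_norm M * norm2 v.
Proof.
have [->|v0] := eqVneq v 0; first by rewrite mulmx0 !norm20 mulr0.
have nv0 : 0 < norm2 v by rewrite lt_def norm2_eq0 v0 norm2_ge0.
rewrite -ler_pdivrMr //.
have := sup_upper_bound (spectral_norm_has_sup M); apply.
exists ((norm2 v)^-1 *: v) => /=.
  by rewrite norm2Z gtr0_norm ?invr_gt0 // mulVf ?gt_eqF.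
by rewrite -scalemxAr norm2Z gtr0_norm ?invr_gt0 // mulrC.
Qed.

Lemma spectral_norm_le (m n : nat) (M : 'M[R]_(m, n)) c : 0 <= c ->
  (forall v, norm2 (M *m v) <= c * norm2 v) -> spectral_norm M <= c.
Proof.
move=> c0 Mc; apply: ge_sup; first by have [] := spectral_norm_has_sup M.
move=> _ [v /= v1 <-].
by rewrite (le_trans (Mc v)) // -[leRHS]mulr1 ler_wpM2l.
Qed.

Lemma spectral_norm_mulmx (m n q : nat) (M : 'M[R]_(m, n)) (N : 'M[R]_(n, q)) :
  spectral_norm (M *m N) <= spectral_norm M * spectral_norm N.
Proof.
apply: spectral_norm_le => [|v]; first by rewrite mulr_ge0 ?spectral_norm_ge0.
rewrite -mulmxA (le_trans (norm2_mulmx_le _ _)) // -mulrA.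
by rewrite ler_wpM2l ?spectral_norm_ge0 // norm2_mulmx_le.
Qed.

(** From [|M^T u|^2 = u.(M M^T u) <= |M M^T| |u|^2]. *)
Lemma spectral_norm_tr_sqr (m n : nat) (M : 'M[R]_(m, n)) :
  spectral_norm M^T ^+ 2 <= spectral_norm (M *m M^T).
Proof.
rewrite -[leRHS]sqr_sqrtr ?spectral_norm_ge0 //.
rewrite ler_pXn2r ?nnegrE ?sqrtr_ge0 ?spectral_norm_ge0 //.
apply: spectral_norm_le => [|u]; first exact: sqrtr_ge0.
rewrite -(@ler_pXn2r _ 2) ?nnegrE ?mulr_ge0 ?norm2_ge0 ?sqrtr_ge0 //.
rewrite exprMn [X in _ <= X * _]sqr_sqrtr ?spectral_norm_ge0 //.
rewrite norm2_sqr_dot trmx_mul trmxK -mulmxA mulmxA -mulmxA.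
apply: le_trans (dot_le_norm2 _ _) _.
by rewrite mulrC expr2 mulrA ler_wpM2r ?norm2_ge0 // mulmxA norm2_mulmx_le.
Qed.

(** By the previous bound and submultiplicativity, [|M^T|^2 <= |M| |M^T|]; divide
    by [|M^T|]. *)
Lemma spectral_norm_tr_le (m n : nat) (M : 'M[R]_(m, n)) :
  spectral_norm M^T <= spectral_norm M.
Proof.
have [->|n0] := eqVneq (spectral_norm M^T) 0; first exact: spectral_norm_ge0.
have p0 : 0 < spectral_norm M^T by rewrite lt_def n0 spectral_norm_ge0.
rewrite -(ler_pM2r p0) -expr2.
exact: le_trans (spectral_norm_tr_sqr M) (spectral_norm_mulmx M M^T).
Qed.

Lemma spectral_norm_tr (m n : nat) (M : 'M[R]_(m, n)) :
  spectral_norm M^T = spectral_norm M.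
Proof.
apply/le_anti; rewrite spectral_norm_tr_le /=.
by rewrite -[M in leLHS]trmxK spectral_norm_tr_le.
Qed.

Lemma spectral_norm_mulmx_tr (m n : nat) (M : 'M[R]_(m, n)) :
  spectral_norm (M *m M^T) = spectral_norm M ^+ 2.
Proof.
apply/le_anti/andP; split.
  by rewrite (le_trans (spectral_norm_mulmx _ _)) // spectral_norm_tr expr2.
by rewrite -[X in X ^+ 2]spectral_norm_tr spectral_norm_tr_sqr.
Qed.

End SpectralNorm.

(** * Vectorization and Kronecker products *)

Section Vec.

Lemma index_allpairs (S T : eqType) (s : seq S) (t : seq T) i j :
  i \in s -> j \in t ->
  index (i, j) [seq (x, y) | x <- s, y <- t]
    = (index i s * size t + index j t)%N.
Proof.
move=> + jt; elim: s => [//|x s IHs]; rewrite inE allpairs_cons index_cat /=.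
have [<- _|xi /= si] := eqVneq i x.
  by rewrite map_f // index_map // => ? ? [].
case: mapP => [[j' _ [ix]]|_]; first by rewrite ix eqxx in xi.
by rewrite size_map IHs // mulSn addnA.
Qed.

(** [mxvec] orders the entries by the enumeration of the pairs of indices and the
    Kronecker product by an explicit formula; both orders are row-major. This is
    what allows Kronecker products to act on vectorized matrices. *)
Lemma mxvec_indexE (m n : nat) (i : 'I_m) (j : 'I_n) :
  mxvec_index i j = mxtens_index (i, j).
Proof.
apply: val_inj => /=.
have -> : enum_rank (i, j) = index (i, j) (enum {: 'I_m * 'I_n}) :> nat.
  rewrite -{2}(nth_enum_rank (i, j) (i, j)) index_uniq ?enum_uniq //.
  by rewrite -cardE ltn_ord.
have -> : enum {: 'I_m * 'I_n}
    = [seq (a, c) | a <- enum 'I_m, c <- enum 'I_n].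
  by rewrite [LHS]enumT unlock.
by rewrite index_allpairs ?mem_enum // !index_enum_ord size_enum_ord.
Qed.

Lemma sum_mxtens (V : nmodType) (n q : nat) (F : 'I_(n * q) -> V) :
  \sum_k F k = \sum_i \sum_j F (mxtens_index (i, j)).
Proof.
rewrite pair_bigA /=; apply: reindex.
exists (@mxtens_unindex n q) => k _; last exact: mxtens_unindexK.
by case: k => i j; rewrite mxtens_indexK.
Qed.

Lemma vecE (T : Type) (m n : nat) (M : 'M[T]_(m, n)) i j :
  vec M (mxtens_index (j, i)) 0 = M i j.
Proof. by rewrite mxE -mxvec_indexE mxvecE mxE. Qed.

End Vec.

Section Kronecker.
Variable R : comPzRingType.

Lemma vecZ (m n : nat) a (M : 'M[R]_(m, n)) : vec (a *: M) = a *: vec M.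
Proof. by rewrite /vec !linearZ. Qed.

Lemma kron_row_idE (n q : nat) (r : 'rV[R]_n) i j k :
  kron_row_id q r i (mxtens_index (j, k)) = r 0 j * (i == k)%:R.
Proof.
rewrite /kron_row_id castmxE /= cast_ord_id.
have -> : cast_ord (esym (mul1n q)) i = mxtens_index (0, i) by exact: val_inj.
by rewrite tensmxE mxE.
Qed.

Lemma kron_id_rowE (n q : nat) (r : 'rV[R]_n) i j k :
  kron_id_row q r i (mxtens_index (j, k)) = (i == j)%:R * r 0 k.
Proof.
rewrite /kron_id_row castmxE /= cast_ord_id.
have -> : cast_ord (esym (muln1 q)) i = mxtens_index (i, 0).
  by apply: val_inj; rewrite /= muln1 addn0.
by rewrite tensmxE mxE.
Qed.

(** With the next lemma, the two cases with a vector factor of the rule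
    [(P (x) Q) vec(M) = vec (Q M P^T)]. *)
Lemma kron_row_id_vec (n q : nat) (r : 'rV[R]_n) (M : 'M[R]_(q, n)) :
  kron_row_id q r *m vec M = M *m r^T.
Proof.
apply/colP => i; rewrite !mxE sum_mxtens; apply: eq_bigr => j _.
rewrite (bigD1 i) //= big1 => [|k ki]; rewrite kron_row_idE.
  by rewrite eqxx mulr1 vecE mxE addr0 mulrC.
by rewrite eq_sym (negPf ki) mulr0 mul0r.
Qed.

Lemma kron_id_row_vec (n q : nat) (r : 'rV[R]_n) (M : 'M[R]_(n, q)) :
  kron_id_row q r *m vec M = M^T *m r^T.
Proof.
apply/colP => i; rewrite !mxE sum_mxtens (bigD1 i) //= [X in _ + X]big1 => [|j ji].
  rewrite addr0; apply: eq_bigr => k _.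
  by rewrite kron_id_rowE eqxx mul1r vecE !mxE mulrC.
rewrite big1 // => k _; rewrite kron_id_rowE eq_sym (negPf ji).
by rewrite mul0r mul0r.
Qed.

(** The columns of a transposed Kronecker product are themselves vectorized
    rank-one matrices, so that the products below reduce to the action on [vec]
    just computed. *)
Lemma col_kron_row_id_tr (n q : nat) (r : 'rV[R]_n) j :
  col j (kron_row_id q r)^T = vec (delta_mx j 0 *m r).
Proof.
apply/colP => k; case: (mxtens_indexP k) => a c.
rewrite vecE !mxE kron_row_idE big_ord1 !mxE eqxx andbT mulrC.
by rewrite eq_sym.
Qed.

Lemma col_kron_id_row_tr (n q : nat) (r : 'rV[R]_n) j :
  col j (kron_id_row q r)^T = vec (r^T *m delta_mx 0 j).
Proof.
apply/colP => k; case: (mxtens_indexP k) => a c.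
rewrite vecE !mxE kron_id_rowE big_ord1 !mxE eqxx /= mulrC.
by rewrite eq_sym.
Qed.

Lemma col_inj_mx (n q : nat) (M N : 'M[R]_(n, q)) :
  (forall j, col j M = col j N) -> M = N.
Proof.
by move=> MN; apply/matrixP => i j; have /colP/(_ i) := MN j; rewrite !mxE.
Qed.

Lemma kron_row_id_gram (n q : nat) (r s : 'rV[R]_n) :
  kron_row_id q r *m (kron_row_id q s)^T = ((s *m r^T) 0 0)%:M.
Proof.
apply: col_inj_mx => j.
rewrite colE -mulmxA -colE col_kron_row_id_tr kron_row_id_vec -mulmxA.
rewrite [s *m _]mx11_scalar mul_mx_scalar colE mul_scalar_mx.
by rewrite -mx11_scalar.
Qed.

Lemma kron_id_row_gram (n q : nat) (r s : 'rV[R]_n) :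
  kron_id_row q r *m (kron_id_row q s)^T = ((s *m r^T) 0 0)%:M.
Proof.
apply: col_inj_mx => j.
rewrite colE -mulmxA -colE col_kron_id_row_tr kron_id_row_vec.
rewrite trmx_mul trmxK -mulmxA trmx_delta.
rewrite [s *m _]mx11_scalar mul_mx_scalar colE mul_scalar_mx.
by rewrite -mx11_scalar.
Qed.

Lemma kron_id_row_row_id (n q : nat) (r : 'rV[R]_q) (s : 'rV[R]_n) :
  kron_id_row n r *m (kron_row_id q s)^T = s^T *m r.
Proof.
apply: col_inj_mx => j.
rewrite colE -mulmxA -colE col_kron_row_id_tr kron_id_row_vec.
rewrite trmx_mul trmx_delta -mulmxA [in RHS]colE -mulmxA; congr (_ *m _).
by apply/matrixP=> a c; rewrite -rowE -colE !mxE !ord1.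
Qed.

Lemma kron_row_id_id_row (n q : nat) (r : 'rV[R]_q) (s : 'rV[R]_n) :
  kron_row_id q s *m (kron_id_row n r)^T = r^T *m s.
Proof.
by rewrite -[LHS]trmxK trmx_mul trmxK kron_id_row_row_id trmx_mul trmxK.
Qed.

End Kronecker.

(** * Algebra of the double saddle point matrix *)

Section DoubleSaddlePoint.
Variables (R : realType) (n m p : nat).
Local Notation l := (n + (m + p))%N.
Local Notation s := (n * n + (n * m + (m * p + (m * m + p * p))))%N.

Definition vecH (H : dspp_data R n m p) : 'cV[R]_s :=
  let: (A, B, C, D, E) := H in
  col_mx (vec A) (col_mx (vec B) (col_mx (vec C) (col_mx (vec D) (vec E)))).

Lemma vec_dataE H b : vec_data H b = col_mx (vecH H) b :> 'cV[R]_(s + l).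
Proof. by case: H => [[[[]]]]. Qed.

Lemma vecHZ a H : vecH (a *: H) = a *: vecH H.
Proof.
case: H => [[[[A B] C] D] E] /=.
by rewrite !scale_col_mx -!vecZ.
Qed.

Lemma dspp_mxD H1 H2 : dspp_mx (H1 + H2) = dspp_mx H1 + dspp_mx H2
  :> 'M[R]_l.
Proof.
case: H1 => [[[[A B] C] D] E]; case: H2 => [[[[A' B'] C'] D'] E'] /=.
by rewrite /block3 !add_col_mx !add_row_mx !linearD /= ?addr0.
Qed.

(** The system matrix is linear in its data, so [dspp_mx H *m w] is also linear
    in [vec H] for fixed [w]: [calG] is the matrix of that map. *)
Lemma calG_vecH H x y z :
  calG x y z *m vecH H = dspp_mx H *m col_mx x (col_mx y z) :> 'cV[R]_l.
Proof.
case: H => [[[[A B] C] D] E].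
rewrite /calG /block3 /= !mul_col_mx !mul_row_col.
by rewrite !mulNmx !kron_row_id_vec !kron_id_row_vec !mul0mx !trmxK
  ?add0r ?addr0 ?addrA [in X in col_mx _ (col_mx X _)]addrAC.
Qed.

(** A block of the product is a sum of Gram matrices of Kronecker factors sharing
    a column block: equal types of factors give scalar matrices, mixed types
    give the outer products of the off-diagonal blocks. *)
Lemma calG_gram x y z : calG x y z *m (calG x y z)^T = calJ x y z :> 'M[R]_l.
Proof.
rewrite /calG /calJ /block3 !tr_col_mx !tr_row_mx.
rewrite !mul_col_mx !mul_mx_row !mul_row_col ?trmx0 ?[(- _)^T]linearN /=.
rewrite !(mul0mx, mulmx0, mulmxN, mulNmx, opprK, oppr0, add0r, addr0).
rewrite !(kron_row_id_gram, kron_id_row_gram, kron_id_row_row_id,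
  kron_row_id_id_row, trmxK).
by rewrite !norm2_sqr_dot !raddfD /= !addrA (addrAC _ _ ((y^T *m y) 0 0)%:M).
Qed.

Lemma calN_gram x y z (Psi chi : R)
    (N := row_mx (Psi *: calG x y z) (- chi%:M) : 'M[R]_(l, s + l)) :
  N *m N^T = Psi ^+ 2 *: calJ x y z + (chi ^+ 2)%:M.
Proof.
rewrite /N tr_row_mx mul_row_col [(- _)^T]linearN [(_ *: _)^T]linearZ /=.
rewrite -scalemxAl -scalemxAr scalerA calG_gram tr_scalar_mx.
by rewrite mulNmx mulmxN opprK -scalar_mxM !expr2.
Qed.

End DoubleSaddlePoint.

(** * Perturbation estimates *)

Section Perturbation.
Variable R : realType.

(** From [u = B^-1 ((B + Delta) u - Delta u)] and [|B^-1 Delta| <= 1/2] comes the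
    lower bound [|u| <= 2 |B^-1| |(B + Delta) u|], hence injectivity and
    [|(B + Delta)^-1| <= 2 |B^-1|].
    The distance between the inverses is then read off
    [(B + Delta)^-1 - B^-1 = - B^-1 Delta (B + Delta)^-1]. *)
Lemma invmx_perturb (l : nat) (B Delta : 'M[R]_l) (e : R) :
  B \in unitmx -> 0 <= e ->
  (forall u, norm2 (Delta *m u) <= e * norm2 u) ->
  spectral_norm (invmx B) * e <= 2^-1 ->
  B + Delta \in unitmx /\
  forall r, norm2 ((invmx (B + Delta) - invmx B) *m r)
              <= 2 * spectral_norm (invmx B) ^+ 2 * e * norm2 r.
Proof.
move=> uB e0 De; set a := spectral_norm (invmx B) => ae.
have a0 : 0 <= a by exact: spectral_norm_ge0.
have key u : norm2 u <= 2 * a * norm2 ((B + Delta) *m u).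
  have : norm2 u <= a * norm2 ((B + Delta) *m u) + a * e * norm2 u.
    rewrite -{1}[u](mulKmx uB).
    have -> : B *m u = (B + Delta) *m u - Delta *m u by rewrite mulmxDl addrK.
    rewrite mulmxBr (le_trans (ler_norm2B _ _)) //.
    rewrite lerD ?norm2_mulmx_le // (le_trans (norm2_mulmx_le _ _)) //.
    by rewrite -mulrA ler_wpM2l.
  have := ler_wpM2r (norm2_ge0 u) ae; lra.
have uBD : B + Delta \in unitmx.
  rewrite -unitmx_tr -row_free_unit; apply: inj_row_free => v vB.
  apply: trmx_inj; rewrite trmx0; apply/eqP; rewrite -norm2_eq0 eq_le norm2_ge0.
  rewrite andbT (le_trans (key _)) //.
  by rewrite -[X in X *m _]trmxK -trmx_mul vB trmx0 norm20 mulr0.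
split=> // r; set u := invmx (B + Delta) *m r.
have -> : (invmx (B + Delta) - invmx B) *m r = - (invmx B *m (Delta *m u)).
  rewrite mulmxBl -/u -{1}[u](mulKmx uB).
  have -> : B *m u = r - Delta *m u.
    by rewrite -[r in RHS](mulKVmx uBD) mulmxDl addrK.
  by rewrite mulmxBr addrAC subrr sub0r.
have ur : norm2 u <= 2 * a * norm2 r.
  by rewrite (le_trans (key u)) // /u mulKVmx.
rewrite norm2N (le_trans (norm2_mulmx_le _ _)) // -/a.
have := le_trans (De u) (ler_wpM2l e0 ur) => h.
rewrite (le_trans (ler_wpM2l a0 h)) // le_eqVlt; apply/orP; left; apply/eqP.
by ring.
Qed.

Variables (n m p k : nat).
Local Notation l := (n + (m + p))%N.
Local Notation s := (n * n + (n * m + (m * p + (m * m + p * p))))%N.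
Implicit Types (H dH : dspp_data R n m p) (b db : 'cV[R]_l).
Implicit Types (L : 'M[R]_(k, l)).

Lemma mxtrace_calJ_le (x : 'cV[R]_n) (y : 'cV[R]_m) (z : 'cV[R]_p) :
  \tr (calJ x y z) <= l%:R * norm2 (col_mx x (col_mx y z)) ^+ 2.
Proof.
rewrite /calJ /block3 /mxtrace !big_split_ord /=.
under eq_bigr do rewrite col_mxEu row_mxEl mxE eqxx mulr1n.
under [X in _ + (X + _)]eq_bigr do
  rewrite col_mxEd col_mxEu row_mxEr row_mxEl mxE eqxx mulr1n.
under [X in _ + (_ + X)]eq_bigr do
  rewrite col_mxEd col_mxEd row_mxEr row_mxEr mxE eqxx mulr1n.
rewrite !sumr_const !card_ord !norm2_col_mx !natrD.
rewrite -[(_ + _) *+ n]mulr_natl -[(_ + _) *+ m]mulr_natl.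
rewrite -[(_ + _) *+ p]mulr_natl.
have := mulr_ge0 (ler0n R n) (sqr_ge0 (norm2 z)).
have := mulr_ge0 (ler0n R p) (sqr_ge0 (norm2 x)).
move: (norm2 x ^+ 2) (norm2 y ^+ 2) (norm2 z ^+ 2) n%:R m%:R p%:R.
by move=> X Y Z i j q; lra.
Qed.

(** The left-hand side is [calG] at the blocks of [u] applied to [vecH H], and the
    squared Frobenius norm of that [calG] is the trace of [calJ]. *)
Lemma norm2_dspp_mulmx H (u : 'cV[R]_l) :
  norm2 (dspp_mx H *m u) <= Num.sqrt l%:R * norm2 (vecH H) * norm2 u.
Proof.
rewrite -(@ler_pXn2r _ 2) ?nnegrE ?mulr_ge0 ?norm2_ge0 ?sqrtr_ge0 //.
rewrite -[u]vsubmxK -[dsubmx u]vsubmxK.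
set x := usubmx u; set y := usubmx _; set z := dsubmx _.
rewrite -calG_vecH (le_trans (norm2_mulmx_trace _ _)) // calG_gram.
rewrite !exprMn [X in _ <= X * _ * _]sqr_sqrtr ?ler0n // mulrAC.
by rewrite ler_wpM2r ?sqr_ge0 // mxtrace_calJ_le.
Qed.

Lemma norm2_vecH_le (Psi chi : R) dH db : 0 < Psi ->
  norm2 (vecH dH) <= Psi * norm2 (vec_data (Psi^-1 *: dH) (chi^-1 *: db)).
Proof.
move=> P0; rewrite vec_dataE vecHZ.
rewrite -(@ler_pXn2r _ 2) ?nnegrE ?mulr_ge0 ?norm2_ge0 ?(ltW P0) //.
rewrite exprMn norm2_col_mx norm2Z exprMn real_normK ?num_real // mulrDr.
rewrite mulrA -exprMn mulfV ?gt_eqF // expr1n mul1r.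
by rewrite lerDl mulr_ge0 ?sqr_ge0.
Qed.

(** Every direction of the perturbation space is realized by some perturbation of
    the data, which makes the supremum as large as the spectral norm. *)
Lemma vec_data_surj (v : 'cV[R]_(s + l)) :
  exists d : dspp_data R n m p * 'cV[R]_l, vec_data d.1 d.2 = v.
Proof.
have vecK (q r : nat) (u : 'cV[R]_(r * q)) : vec (vec_mx u^T)^T = u.
  by rewrite /vec trmxK vec_mxK trmxK.
rewrite -[v]vsubmxK -[usubmx v]vsubmxK -[dsubmx (usubmx v)]vsubmxK.
rewrite -[dsubmx (dsubmx (usubmx v))]vsubmxK.
rewrite -[dsubmx (dsubmx (dsubmx (usubmx v)))]vsubmxK.
set v1 := usubmx _; set v2 := usubmx _; set v3 := usubmx _.
set v4 := usubmx _; set v5 := dsubmx _; set v6 := dsubmx _.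
exists ((vec_mx v1^T)^T, (vec_mx v2^T)^T, (vec_mx v3^T)^T, (vec_mx v4^T)^T,
  (vec_mx v5^T)^T, v6).
by rewrite /= !vecK.
Qed.

(** No approximation is made here: the perturbed inverse is kept, and the
    right-hand side of the perturbed system is rewritten as
    [(B + Delta) w - (Delta w - db)]. *)
Lemma phi_perturb L H b dH db (x : 'cV[R]_n) (y : 'cV[R]_m) (z : 'cV[R]_p)
    (Psi chi : R) :
  Psi != 0 -> chi != 0 ->
  dspp_mx H \in unitmx -> dspp_mx (H + dH) \in unitmx ->
  dspp_mx H *m col_mx x (col_mx y z) = b ->
  phi L (H + dH) (b + db) - phi L H b =
  - (L *m (invmx (dspp_mx (H + dH)) *m
       (row_mx (Psi *: calG x y z) (- chi%:M) *m
         vec_data (Psi^-1 *: dH) (chi^-1 *: db)))).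
Proof.
move=> P0 c0 uH uHd Hw.
rewrite vec_dataE vecHZ mul_row_col -scalemxAl -scalemxAr scalerA.
rewrite mulfV // scale1r calG_vecH mulNmx mul_scalar_mx scalerA mulfV //.
rewrite scale1r /phi -!mulmxA -mulmxBr -[in RHS]mulmxN; congr (_ *m _).
have -> : b + db = dspp_mx (H + dH) *m col_mx x (col_mx y z)
   - (dspp_mx dH *m col_mx x (col_mx y z) - db).
  by rewrite dspp_mxD mulmxDl Hw opprB addrA addrAC addrK.
by rewrite mulmxBr mulKmx // -Hw mulKmx // addrAC subrr sub0r.
Qed.

End Perturbation.

(** * Limit of the difference quotients *)

Section ConditionNumber.
Variables (R : realType) (n m p k : nat).
Local Notation l := (n + (m + p))%N.
Variables (H : dspp_data R n m p) (b : 'cV[R]_l) (L : 'M[R]_(k, l)).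
Variables (x : 'cV[R]_n) (y : 'cV[R]_m) (z : 'cV[R]_p) (Psi chi xiL : R).
Hypotheses (hPsi : 0 < Psi) (hchi : 0 < chi) (hxiL : 0 < xiL).
Hypothesis uH : dspp_mx H \in unitmx.
Hypothesis Hw : dspp_mx H *m col_mx x (col_mx y z) = b.

Let N := row_mx (Psi *: calG x y z) (- chi%:M).
Let M := L *m invmx (dspp_mx H) *m N.
(* A perturbation of scaled size at most [eps] moves the system matrix by at most
   [rate * eps] in spectral norm; [c * eps] is the resulting error on the first-order
   term, relative to the size of the perturbation. *)
Let nB := spectral_norm (invmx (dspp_mx H)).
Let rate := Num.sqrt l%:R * Psi.
Let c := spectral_norm L * (2 * nB ^+ 2 * rate) * spectral_norm N.

(** The first-order term [M v] approximates the variation of [phi] with an error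
    that is uniform in the direction of [v]; this uniformity is what lets the
    supremum pass to the limit. *)
Lemma phi_first_order dH db eps v :
  vec_data (Psi^-1 *: dH) (chi^-1 *: db) = v ->
  norm2 v <= eps -> nB * (rate * eps) <= 2^-1 ->
  `|norm2 (phi L (H + dH) (b + db) - phi L H b) - norm2 (M *m v)|
    <= c * eps * norm2 v.
Proof.
move=> vE veps small.
have rate0 : 0 <= rate by rewrite mulr_ge0 ?sqrtr_ge0 ?ltW.
have nB0 : 0 <= nB by exact: spectral_norm_ge0.
have eps0 : 0 <= eps by rewrite (le_trans (norm2_ge0 v)).
have De u : norm2 (dspp_mx dH *m u) <= rate * eps * norm2 u.
  rewrite (le_trans (norm2_dspp_mulmx _ _)) // ler_wpM2r ?norm2_ge0 //.
  rewrite /rate -mulrA ler_wpM2l ?sqrtr_ge0 //.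
  rewrite (le_trans (norm2_vecH_le chi dH db hPsi)) // vE.
  by rewrite ler_wpM2l // ltW.
have [uHd inv_close] := invmx_perturb uH (mulr_ge0 rate0 eps0) De small.
rewrite -dspp_mxD in uHd inv_close.
rewrite (phi_perturb L db (lt0r_neq0 hPsi) (lt0r_neq0 hchi) uH uHd Hw).
rewrite norm2N vE -/N; set f := invmx (dspp_mx (H + dH)).
have lip (w1 w2 : 'cV[R]_k) : `|norm2 w1 - norm2 w2| <= norm2 (w1 - w2).
  have h1 := ler_norm2D (w1 - w2) w2; have h2 := ler_norm2D (w2 - w1) w1.
  have h3 : norm2 (w2 - w1) = norm2 (w1 - w2) by rewrite -norm2N opprB.
  rewrite !subrK h3 in h1 h2; rewrite ler_norml; apply/andP; split; lra.
rewrite (le_trans (lip _ _)) // /M -!mulmxA -!mulmxBr -mulmxBl.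
rewrite (le_trans (norm2_mulmx_le _ _)) // /c.
have h := inv_close (N *m v); rewrite -/nB -/f in h.
have h2 := norm2_mulmx_le N v.
have q0 : 0 <= 2 * nB ^+ 2 * (rate * eps).
  by apply: mulr_ge0; apply: mulr_ge0 => //; exact: sqr_ge0.
rewrite (le_trans (ler_wpM2l (spectral_norm_ge0 L)
  (le_trans h (ler_wpM2l q0 h2)))) //.
by rewrite le_eqVlt; apply/orP; left; apply/eqP; ring.
Qed.

(** For the lower bound, each nonzero [v] is rescaled to length [eps] and realized
    by a perturbation; the ratio [|M v| / |v|] does not see the rescaling. Since
    the supremum is finite by the upper bound, these inequalities say that it
    bounds the spectral norm of [M] up to the error term. *)
Lemma cond_sup_bounds eps : (0 < l)%N -> 0 < eps -> nB * (rate * eps) <= 2^-1 ->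
  ((spectral_norm M / xiL - c / xiL * eps)%:E
     <= cond_sup Psi chi xiL L H b eps
     <= (spectral_norm M / xiL + c / xiL * eps)%:E)%E.
Proof.
move=> l0 eps0 small; set T := cond_sup _ _ _ _ _ _ _.
have ix : 0 < xiL^-1 by rewrite invr_gt0.
have upper : (T <= (spectral_norm M / xiL + c / xiL * eps)%:E)%E.
  apply: ge_ereal_sup => _ [[dH db] /= /andP[v0 veps] <-].
  rewrite lee_fin; have := phi_first_order erefl veps small.
  set v := vec_data _ _ in v0 veps *.
  have := norm2_mulmx_le M v.
  set X := norm2 (phi _ _ _ - _); rewrite ler_norml => h1 /andP[_ h2].
  rewrite ler_pdivrMr // mulrC.
  rewrite [leRHS](_ : _ =
    (spectral_norm M * norm2 v + c * eps * norm2 v) / xiL); last by ring.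
  by rewrite ler_wpM2r ?(ltW ix) //; lra.
rewrite upper andbT.
have lower v : v != 0 ->
    ((xiL^-1 * (norm2 (M *m v) / norm2 v - c * eps))%:E <= T)%E.
  move=> v0; have nv0 : 0 < norm2 v by rewrite lt_def norm2_eq0 v0 norm2_ge0.
  have [[dH db] /= dE] := vec_data_surj ((eps / norm2 v) *: v).
  pose dH' := Psi *: dH; pose db' := chi *: db.
  have vE : vec_data (Psi^-1 *: dH') (chi^-1 *: db') = (eps / norm2 v) *: v.
    by rewrite !scalerA !mulVf ?gt_eqF // !scale1r.
  have nE : norm2 ((eps / norm2 v) *: v) = eps.
    by rewrite norm2Z gtr0_norm ?divr_gt0 // divfK ?gt_eqF.
  apply: le_trans (ereal_sup_ubound _); last first.
    exists (dH', db'); last reflexivity.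
    by rewrite /mkset [(dH', db').1]/= [(dH', db').2]/= vE nE eps0 lexx.
  rewrite [(dH', db').1]/= [(dH', db').2]/= lee_fin vE nE -mulrA.
  rewrite ler_wpM2l ?(ltW ix) //.
  have := @phi_first_order dH' db' eps _ vE; rewrite nE => /(_ (lexx _) small).
  rewrite -scalemxAr norm2Z (gtr0_norm (divr_gt0 eps0 nv0)) ler_norml => /andP[h _].
  rewrite ler_pdivlMr //; apply: le_trans (_ : eps / norm2 v * norm2 (M *m v)
    - c * eps * eps <= _); last by lra.
  by rewrite le_eqVlt; apply/orP; left; apply/eqP; ring.
(* Positivity of the dimension provides a nonzero perturbation, without which the
   supremum would be that of the empty set. *)
have [v0 v0n] : exists v : 'cV[R]_(n * n + (n * m + (m * p + (m * m + p * p))) + l),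
    v != 0.
  exists (const_mx 1); apply/eqP => /colP.
  have j := Ordinal l0.
  by move=> /(_ (rshift _ j)); rewrite !mxE; apply/eqP; rewrite oner_eq0.
have := lower v0 v0n; case: T upper lower => [t| |] //= _ lower hv0.
have tP v : v != 0 -> norm2 (M *m v) <= (xiL * t + c * eps) * norm2 v.
  move=> vn0; have nv0 : 0 < norm2 v by rewrite lt_def norm2_eq0 vn0 norm2_ge0.
  have := lower v vn0; rewrite lee_fin ler_pdivrMl // lerBlDr.
  by rewrite ler_pdivrMr.
rewrite lee_fin lerBlDr ler_pdivrMr //.
have -> : (t + c / xiL * eps) * xiL = xiL * t + c * eps.
  by field; rewrite gt_eqF.
apply: spectral_norm_le => [|v].
  have nv0 : 0 < norm2 v0 by rewrite lt_def norm2_eq0 v0n norm2_ge0.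
  by rewrite -(pmulr_lge0 _ nv0) (le_trans _ (tP _ v0n)) ?norm2_ge0.
have [->|] := eqVneq v 0; last exact: tP.
by rewrite mulmx0 !norm20 mulr0.
Qed.

Lemma cond_sup_cvg : (0 < l)%N ->
  cond_sup Psi chi xiL L H b eps @[eps --> 0^'+]
    --> (spectral_norm M / xiL)%:E.
Proof.
move=> l0.
have lim_lin (c' : R) : (spectral_norm M / xiL + c' * eps)%:E @[eps --> 0^'+]
    --> (spectral_norm M / xiL)%:E.
  apply: cvg_EFin; first by near=> eps.
  apply: cvg_at_right_filter.
  rewrite -[X in _ --> X]addr0 -[X in _ + X](mulr0 c').
  by apply: cvgD; [exact: cvg_cst|apply: cvgMl_tmp; exact: cvg_id].
apply: (@squeeze_cvge _ _ _ _ (fun eps => (spectral_norm M / xiL - c / xiL * eps)%:E)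
   _ (fun eps => (spectral_norm M / xiL + c / xiL * eps)%:E)); last first.
- exact: lim_lin.
- by under eq_cvg do rewrite -mulNr; exact: lim_lin.
have rate0 : 0 <= rate by rewrite mulr_ge0 ?sqrtr_ge0 ?ltW.
have nB0 : 0 <= nB by exact: spectral_norm_ge0.
near=> eps; apply: cond_sup_bounds => //.
(* The summand 1 keeps the denominator positive when [nB * rate = 0]. *)
have : eps <= (2 * (nB * rate + 1))^-1.
  near: eps; apply: nbhs_right_le; rewrite invr_gt0 mulr_gt0 //.
  by rewrite ltr_wpDl // mulr_ge0.
move=> h; rewrite mulrA; apply: le_trans (ler_wpM2l _ h) _.
  by rewrite mulr_ge0.
have q0 : 0 < nB * rate + 1 by rewrite ltr_wpDl // mulr_ge0.
rewrite invfM mulrCA ler_piMr ?invr_ge0 // ler_pdivrMr // mul1r lerDl //.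
Unshelve. all: by end_near.
Qed.

End ConditionNumber.

(** * The two formulas *)

Theorem theorem2 (R : realType) (n m p k : nat)
    (A : 'M[R]_n) (B : 'M[R]_(m, n)) (C : 'M[R]_(p, m))
    (D : 'M[R]_m) (E : 'M[R]_p) (b : 'cV[R]_(n + (m + p)))
    (x : 'cV[R]_n) (y : 'cV[R]_m) (z : 'cV[R]_p)
    (L : 'M[R]_(k, n + (m + p))) (Psi chi xiL : R)
    (hl : (0 < n + (m + p))%N) (hk : (k <= n + (m + p))%N)
    (hPsi : 0 < Psi) (hchi : 0 < chi) (hxiL : 0 < xiL)
    (hB : dspp_mx (A, B, C, D, E) \in unitmx)
    (hw : dspp_mx (A, B, C, D, E) *m col_mx x (col_mx y z) = b) :
  [/\ cvg (cond_sup Psi chi xiL L (A, B, C, D, E) b eps @[eps --> 0^'+]),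
      partial_cond Psi chi xiL L (A, B, C, D, E) b =
        (spectral_norm (L *m invmx (dspp_mx (A, B, C, D, E)) *m
           row_mx (Psi *: calG x y z) (- chi%:M)) / xiL)%:E
    & partial_cond Psi chi xiL L (A, B, C, D, E) b =
        (Num.sqrt (spectral_norm (L *m invmx (dspp_mx (A, B, C, D, E)) *m
           (Psi ^+ 2 *: calJ x y z + (chi ^+ 2)%:M) *m
           (invmx (dspp_mx (A, B, C, D, E)))^T *m L^T)) / xiL)%:E].
Proof.
have cv := @cond_sup_cvg _ _ _ _ _ _ _ L _ _ _ _ _ _ hPsi hchi hxiL hB hw hl.
have condE := cvg_lim (@ereal_hausdorff R) cv.
split; [by apply/cvg_ex; eexists; exact: cv|exact: condE|].
rewrite /partial_cond condE; congr ((_ / _)%:E).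
set invB := invmx _; set N := row_mx _ _.
have -> : L *m invB *m (Psi ^+ 2 *: calJ x y z + (chi ^+ 2)%:M) *m invB^T *m L^T
    = (L *m invB *m N) *m (L *m invB *m N)^T.
  by rewrite -calN_gram !trmx_mul !mulmxA.
by rewrite spectral_norm_mulmx_tr sqrtr_sqr ger0_norm ?spectral_norm_ge0.
Qed.
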